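(* Let $H$ be a complex Hilbert space and $T\in B(H)$. If $T$ is a power partial isometry, then $\mathcal S(T,T^* )$ is an SI semigroup.
   Context: $H$ may be finite or infinite dimensional; $B(H)$ is the set of bounded linear operators on $H$. $T$ is a power partial isometry if $T^n$ is a partial isometry for every $n\ge1$. $\mathcal S(T,T^* )$ is the semigroup generated by $\{T,T^*\}$, i.e. the set of all finite nonempty words in $T$ and $T^*$. An ideal $J$ of a multiplicative semigroup $\mathcal S\subset B(H)$ is a (two-sided) multiplicative ideal: a subset $J\subset\mathcal S$ with $XA, AX\in J$ for all $A\in J$, $X\in\mathcal S$ (no closure under sums or scalars is required). $\mathcal S$ is a selfadjoint-ideal (SI) semigroup if every ideal $J$ of $\mathcal S$ satisfies $\{A^*: A\in J\}\subset J$. *)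

(* Defs.v *)
From HB Require Import structures.
From mathcomp Require Import all_boot all_order all_algebra.
From mathcomp Require Import complex.
From mathcomp Require Import ring lra.
From mathcomp Require Import all_classical all_reals.
From mathcomp Require Import topology normedtype.

Set Implicit Arguments.
Unset Strict Implicit.
Unset Printing Implicit Defensive.

Import Order.TTheory GRing.Theory Num.Theory.
Import numFieldNormedType.Exports.

Local Open Scope classical_set_scope.
Local Open Scope ring_scope.

HB.mixin Record CompleteNormedModule_isHilbert (R : realType) (H : Type)
    of CompleteNormedModule R[i] H := {
  inner : {dot H for @Num.conj R[i]};
  inner_normE : forall x : H, inner x x = `|x| ^+ 2
}.

#[short(type="hilbertType")]
HB.structure Definition Hilbert (R : realType) :=
  {H of CompleteNormedModule R[i] H & CompleteNormedModule_isHilbert R H}.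

Section BoundedOperators.
Context {R : realType} (H : hilbertType R).

Record bop := BOp {
  bop_fun :> H -> H;
  bop_linear : linear bop_fun;
  bop_bounded : exists M : R, forall x, `|bop_fun x| <= M%:C%C * `|x|
}.

HB.instance Definition _ (A : bop) :=
  GRing.isLinear.Build R[i] H H *:%R (bop_fun A) (bop_linear A).

Lemma bopP (A B : bop) : A =1 B -> A = B.
Proof.
case: A B => [A lA bA] [B lB bB] /= /funext AB.
by case: B / AB lB bB => lB bB; congr BOp; exact: Prop_irrelevance.
Qed.

Lemma bop_bounded_ge0 (A : bop) :
  exists2 M : R, 0 <= M & forall x, `|A x| <= M%:C%C * `|x|.
Proof.
have [M AM] := bop_bounded A; exists `|M| => // x.
by apply: le_trans (AM x) _; rewrite ler_wpM2r// lecR ler_norm.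
Qed.

Fact bop_id_linear : linear (@id H). Proof. by []. Qed.

Fact bop_id_bounded : exists M : R, forall x : H, `|id x| <= M%:C%C * `|x|.
Proof. by exists 1 => x; rewrite mul1r. Qed.

Definition bop_id : bop := BOp bop_id_linear bop_id_bounded.

Fact bop_comp_linear (A B : bop) : linear (A \o B).
Proof. by move=> a x y; rewrite /= !linearP. Qed.

Fact bop_comp_bounded (A B : bop) :
  exists M : R, forall x, `|(A \o B) x| <= M%:C%C * `|x|.
Proof.
have [M M0 AM] := bop_bounded_ge0 A; have [N N0 BN] := bop_bounded_ge0 B.
exists (M * N) => x; apply: le_trans (AM _) _.
by rewrite rmorphM -mulrA ler_wpM2l// (@lecR R 0).
Qed.

Definition bop_comp (A B : bop) : bop :=
  BOp (bop_comp_linear A B) (bop_comp_bounded A B).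

Lemma bop_compA : associative bop_comp. Proof. by move=> A B D; exact: bopP. Qed.
Lemma bop_comp1o : left_id bop_id bop_comp. Proof. by move=> A; exact: bopP. Qed.
Lemma bop_compo1 : right_id bop_id bop_comp. Proof. by move=> A; exact: bopP. Qed.

HB.instance Definition _ :=
  Monoid.isLaw.Build bop bop_id bop_comp bop_compA bop_comp1o bop_compo1.

Definition bop_pow (A : bop) (n : nat) : bop := iter n (bop_comp A) bop_id.

End BoundedOperators.

Section Riesz.
Context {R : realType} {H : hilbertType R}.
Implicit Types (x y z : H) (r : R).

Let rip x y : R := complex.Re (inner x y).

Let Re_conjC (u : R[i]) : complex.Re (Num.conj u) = complex.Re u.
Proof. by case: u. Qed.

Let ripC x y : rip x y = rip y x.
Proof.
rewrite /rip (hermitian_subproof x y) expr0 mul1r.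
exact: Re_conjC.
Qed.

Let ripDl x y z : rip (x + y) z = rip x z + rip y z.
Proof. by rewrite /rip linearDl raddfD. Qed.

Let ripDr x y z : rip z (x + y) = rip z x + rip z y.
Proof. by rewrite !(ripC z) ripDl. Qed.

Let ripZl r x y : rip (r%:C%C *: x) y = r * rip x y.
Proof.
rewrite /rip linearZl_LR /=.
by case: (inner x y) => a b /=; rewrite mul0r subr0.
Qed.

Let ripZr r x y : rip y (r%:C%C *: x) = r * rip y x.
Proof. by rewrite !(ripC y) ripZl. Qed.

Let rip_norm x : (rip x x)%:C%C = `|x| ^+ 2.
Proof.
have /ger0_real : 0 <= inner x x by rewrite inner_normE exprn_ge0.
by rewrite /rip -inner_normE => /complex_realP [k ->].
Qed.

Let rip_ge0 x : 0 <= rip x x.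
Proof. by rewrite -(@ler0c R) rip_norm exprn_ge0. Qed.

Let rip_CS x y : rip x y ^+ 2 <= rip x x * rip y y.
Proof.
have Q t : 0 <= rip x x - 2 * t * rip x y + t ^+ 2 * rip y y.
  have := rip_ge0 (x + (- t)%:C%C *: y).
  rewrite !(ripDl, ripDr) !(ripZl, ripZr) (ripC y x) => /le_trans; apply.
  by rewrite le_eqVlt; apply/orP; left; apply/eqP; ring.
have [y0|y0] := eqVneq (rip y y) 0.
  rewrite y0 mulr0; have [->|xy0] := eqVneq (rip x y) 0.
    by rewrite expr0n.
  have := Q ((rip x x + 1) / (2 * rip x y)); rewrite y0 mulr0 addr0.
  have -> : 2 * ((rip x x + 1) / (2 * rip x y)) * rip x y = rip x x + 1.
    by field.
  by lra.
have ygt0 : 0 < rip y y by rewrite lt_def y0 rip_ge0.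
have := Q (rip x y / rip y y).
have -> : rip x x - 2 * (rip x y / rip y y) * rip x y
    + (rip x y / rip y y) ^+ 2 * rip y y
    = (rip x x * rip y y - rip x y ^+ 2) / rip y y by field.
by rewrite pmulr_lge0 ?invr_gt0// subr_ge0.
Qed.

Let norm_lt x r : 0 < r -> (`|x| < r%:C%C) = (rip x x < r ^+ 2).
Proof.
move=> r0; rewrite -(@ltcR R) rip_norm rmorphXn /= ltr_sqr ?nnegrE//.
by rewrite (@lecR R 0) ltW.
Qed.

Let small_eq0 (D k : R) : 0 < k -> 0 <= D ->
  (forall e, 0 < e -> e <= 1 -> D <= 4 * k * e) -> D = 0.
Proof.
move=> k0 D0 bnd; apply/eqP; rewrite eq_le D0 andbT leNgt; apply/negP => Dgt.
have p0 : 0 < 8 * k + D by lra.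
have s0 : 0 < D / (8 * k + D) by rewrite divr_gt0.
have s1 : D / (8 * k + D) <= 1 by rewrite ler_pdivrMr// mul1r; lra.
have := bnd _ s0 s1; rewrite mulrA ler_pdivlMr//; nra.
Qed.

Let real_riesz (f : H -> R) (K : R) :
    {morph f : x y / x + y} -> (forall r x, f (r%:C%C *: x) = r * f x) ->
    (forall x, f x ^+ 2 <= K * rip x x) ->
  exists z, forall x, f x = rip x z.
Proof.
move=> fD fZ fK.
pose J x := rip x x - 2 * f x.
have JK x : - `|K| <= J x.
  have := fK x; have := rip_ge0 x; have := ler_norm K; have := normr_ge0 K.
  rewrite /J; move: (rip x x) (f x) `|K| => q a k k0 Kk q0 aK.
  have aK' : a ^+ 2 <= k * q by apply: le_trans aK _; rewrite ler_wpM2r.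
  rewrite leNgt; apply/negP => h.
  have : 0 < (2 * a - q - k) * (2 * a + q + k) by apply: mulr_gt0; lra.
  by have := sqr_ge0 (q - k); nra.
have Jinf : has_inf (range J).
  by split; [exists (J 0), 0|exists (- `|K|) => _ [x _ <-]].
pose m := inf (range J).
have mJ x : m <= J x by apply: ge_inf; [case: Jinf|exists x].
have adh e : 0 < e -> exists x, J x < m + e.
  by move=> /inf_adherent /(_ Jinf) [_ [x _ <-]]; exists x.
have para x y : rip (x - y) (x - y) = 2 * (J x + J y) - 4 * J (2^-1%:C%C *: (x + y)).
  have -> : x - y = x + (-1)%:C%C *: y by rewrite rmorphN rmorph1 scaleN1r.
  rewrite /J !fZ fD !(ripDl, ripDr, ripZl, ripZr) (ripC y x).
  by field.
pose F : set_system H :=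
  [set A | exists2 e : R, 0 < e & [set x | J x < m + e] `<=` A].
have FF : ProperFilter F.
  apply: Build_ProperFilter_ex.
    by move=> A [e e0 eA]; have [x xe] := adh _ e0; exists x; exact: eA.
  split; first by exists 1.
    move=> A B [e e0 eA] [d d0 dB]; exists (Num.min e d).
      by rewrite lt_min e0.
    move=> x /= xed; split; [apply: eA|apply: dB]; apply: lt_le_trans xed _;
      by rewrite lerD2l ge_min lexx ?orbT.
  by move=> A B AB [e e0 eA]; exists e => //; exact: subset_trans AB.
have /cauchy_cvgP/cvg_ex [z Fz] : cauchy F.
  apply/cauchy_ballP => E E0.
  have /complex_realP [r Er] := gtr0_real E0.
  have r0 : 0 < r by rewrite -(@ltcR R 0) -Er.
  pose d := r ^+ 2 / 8.
  have d0 : 0 < d by rewrite divr_gt0// exprn_gt0.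
  have Fd : F [set x | J x < m + d] by exists d.
  exists ([set x | J x < m + d], [set x | J x < m + d]) => //=.
  move=> [x y] /= [xd yd]; rewrite -ball_normE /= Er norm_lt// para.
  have := mJ (2^-1%:C%C *: (x + y)).
  have : 0 < r ^+ 2 by rewrite exprn_gt0.
  by move: xd yd; rewrite /d; lra.
exists z => h; apply/eqP; rewrite -subr_eq0 -sqrf_eq0; apply/eqP.
set k := rip h h + 1; set D := _ ^+ 2.
have k0 : 0 < k by rewrite ltr_wpDl.
have D0 : 0 <= D by exact: sqr_ge0.
apply: (small_eq0 k0 D0) => e e0 e1.
have [d d0 dz] : F (ball z e%:C%C) by apply: Fz; apply: nbhsx_ballx; rewrite (@ltcR R 0).
have [x xd] : exists x, J x < m + Num.min d e by apply: adh; rewrite lt_min d0.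
have xz : rip (z - x) (z - x) < e ^+ 2.
  rewrite -norm_lt//.
  have : ball z e%:C%C x.
    by apply: dz => /=; apply: lt_le_trans xd _; rewrite lerD2l ge_min lexx.
  by rewrite -ball_normE.
have xe : J x < m + e.
  by apply: lt_le_trans xd _; rewrite lerD2l ge_min lexx orbT.
pose a := rip h x - f h.
have ak : a ^+ 2 <= k * e.
  have := mJ (x + (- (a / k))%:C%C *: h).
  rewrite /J !(ripDl, ripDr, ripZl, ripZr) fD fZ (ripC x h) => mx.
  have : - e < - (a / k) * (2 * a) + (a / k) ^+ 2 * rip h h.
    move: mx xe; rewrite /J /a; nra.
  have -> : rip h h = k - 1 by rewrite /k addrK.
  have -> : - (a / k) * (2 * a) + (a / k) ^+ 2 * (k - 1)
     = - (a ^+ 2 / k) - (a / k) ^+ 2 by field; rewrite gt_eqF.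
  have := sqr_ge0 (a / k) => ? ?.
  have : a ^+ 2 / k <= e by lra.
  by rewrite ler_pdivrMr// mulrC.
have := rip_CS h (z - x).
have -> : rip h (z - x) = rip h z - rip h x.
  have -> : z - x = z + (-1)%:C%C *: x by rewrite rmorphN rmorph1 scaleN1r.
  by rewrite ripDr ripZr mulN1r.
set b := _ - _ => bCS.
have bk : b ^+ 2 <= k * e.
  apply: le_trans bCS _; apply: ler_pM => //; first by rewrite /k lerDl.
  by apply: le_trans (ltW xz) _; rewrite expr2 ler_piMl// ltW.
rewrite /D; have -> : f h - rip h z = - (a + b) by rewrite /a /b; ring.
have := sqr_ge0 (a - b); nra.
Qed.

Let Re_iM (u : R[i]) : complex.Re ('i%C * u) = - complex.Im u.
Proof. by case: u => a b /=; rewrite mul0r mul1r sub0r. Qed.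

Let eq_Re (g1 g2 : H -> R[i]) :
    (forall x, g1 ('i%C *: x) = 'i%C * g1 x) ->
    (forall x, g2 ('i%C *: x) = 'i%C * g2 x) ->
  (forall x, complex.Re (g1 x) = complex.Re (g2 x)) -> g1 =1 g2.
Proof.
move=> g1i g2i e x; apply/eqP; rewrite eq_complex e eqxx /=.
by have := e ('i%C *: x); rewrite g1i g2i !Re_iM => /oppr_inj ->.
Qed.

Lemma inner_inj y z : (forall x, inner x y = inner x z) -> y = z.
Proof.
move=> e; apply/eqP; rewrite -subr_eq0 -(dnorm_eq0 (@inner R H)).
by rewrite linearBr /= e subrr.
Qed.

Fact adjoint_exists (T : bop H) :
  exists S : bop H, forall x y, inner (T x) y = inner x (S y).
Proof.
have [N N0 TN] := bop_bounded_ge0 T.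
have N0c : 0 <= N%:C%C by rewrite (@lecR R 0).
have riesz y : exists z, forall x, inner (T x) y = inner x z.
  have [|||z zP] := @real_riesz (fun x => rip (T x) y) (N ^+ 2 * rip y y).
  - by move=> u v; rewrite linearD ripDl.
  - by move=> r x; rewrite linearZ ripZl.
  - move=> x; apply: le_trans (rip_CS _ _) _.
    rewrite mulrAC ler_wpM2r// -(@lecR R) rmorphM rmorphXn /= !rip_norm.
    by rewrite -exprMn lerXn2r// nnegrE ?mulr_ge0.
  exists z; apply: eq_Re => // x.
    by rewrite linearZ linearZl_LR.
  by rewrite linearZl_LR.
have [S SP] := choice riesz.
have Slin : linear S.
  move=> a u v; apply: inner_inj => x.
  by rewrite -SP !linearPr /= !SP.
have Sbnd : exists M : R, forall y, `|S y| <= M%:C%C * `|y|.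
  exists N => y.
  have [->|Sy0] := eqVneq (S y) 0; first by rewrite normr0 mulr_ge0.
  have Sy : 0 < `|S y| by rewrite normr_gt0.
  rewrite -(ler_pM2l Sy).
  have h : `|S y| ^+ 2 = (rip (T (S y)) y)%:C%C.
    by rewrite -rip_norm /rip SP.
  have := rip_CS (T (S y)) y.
  rewrite -(@lecR R) rmorphXn rmorphM /= -h !rip_norm -exprMn ler_sqr ?nnegrE ?mulr_ge0//.
  rewrite expr2 => /le_trans; apply.
  by rewrite mulrA (mulrC _ N%:C%C) ler_wpM2r.
by exists (BOp Slin Sbnd).
Qed.

End Riesz.

Section SISemigroups.
Context {R : realType} {H : hilbertType R}.
Implicit Types (A B T X : bop H) (S J : set (bop H)).

Definition adjoint T : bop H := sval (cid (adjoint_exists T)).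

Lemma adjointP T x y : inner (T x) y = inner x (adjoint T y).
Proof. by rewrite /adjoint; case: cid. Qed.

Definition partial_isometry T : Prop :=
  forall x, (forall z, T z = 0 -> inner x z = 0) -> `|T x| = `|x|.

Definition power_partial_isometry T : Prop :=
  forall n, (1 <= n)%N -> partial_isometry (bop_pow T n).

(* A word in T and T^* is encoded by a sequence of booleans, [true] standing
   for the letter T^*. *)
Definition word_bop T (w : seq bool) : bop H :=
  \big[@bop_comp R H/bop_id H]_(b <- w) (if b then adjoint T else T).

Definition semigroup_TTs T : set (bop H) :=
  [set A | exists2 w : seq bool, w != [::] & A = word_bop T w].

Definition mul_semigroup S : Prop :=
  forall A B, S A -> S B -> S (bop_comp A B).

Definition mul_ideal S J : Prop :=
  J `<=` S /\
  forall A X, J A -> S X -> J (bop_comp X A) /\ J (bop_comp A X).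

Definition SI_semigroup S : Prop :=
  mul_semigroup S /\ forall J, mul_ideal S J -> [set adjoint A | A in J] `<=` J.

End SISemigroups.

(* Main.v *)
Require Import Defs.
From HB Require Import structures.
From mathcomp Require Import all_boot all_order all_algebra.
From mathcomp Require Import complex.
From mathcomp Require Import all_classical all_reals.
From mathcomp Require Import topology normedtype.

(** Every word [W] in [T] and [T^*] turns out to satisfy [W W^* W = W], so that
    [W^* = W^* W W^*] lies in every ideal containing [W]. The projections
    [E_m = T^*^m T^m] and [F_n = T^n T^*^n] commute with one another, because
    [T^m], [T^n] and [T^(m+n)] are partial isometries (Halmos and Wallen). The
    commutative monoid they generate is stable under [P |-> T P T^*] and
    [P |-> T^* P T]; hence it contains [W W^*] for every word [W], and the
    identity [W W^* W = W] propagates from [W] to [T W] and [T^* W]. *)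

Set Implicit Arguments.
Unset Strict Implicit.
Unset Printing Implicit Defensive.

Import Order.TTheory GRing.Theory Num.Theory.

Local Open Scope classical_set_scope.
Local Open Scope ring_scope.

Local Notation "A ∘ B" := (bop_comp A B) (at level 40, left associativity).
Local Notation "A ^*" := (adjoint A).

(** * Calculus of adjoints *)

Section Adjoint.
Context {R : realType} {H : hilbertType R}.
Implicit Types (A B C : bop H) (x y z : H).

Lemma innerC x y : inner x y = Num.conj (inner y x).
Proof. by rewrite (hermitian_subproof x y) expr0 mul1r. Qed.

Lemma inner_eq0 x : inner x x = 0 -> x = 0.
Proof. by move/eqP; rewrite dnorm_eq0 => /eqP. Qed.

Lemma adjoint_eq A B : (forall x y, inner (A x) y = inner x (B y)) -> A^* = B.
Proof.
by move=> AB; apply: bopP => y; apply: inner_inj => x; rewrite -adjointP AB.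
Qed.

Lemma adjointK : involutive (@adjoint R H).
Proof.
move=> A; apply: adjoint_eq => x y.
by rewrite innerC -adjointP -innerC.
Qed.

Lemma adjoint_comp A B : (A ∘ B)^* = B^* ∘ A^*.
Proof. by apply: adjoint_eq => x y /=; rewrite !adjointP. Qed.

Lemma adjoint_id : (bop_id H)^* = bop_id H.
Proof. exact: adjoint_eq. Qed.

End Adjoint.

(** * Partial isometries as solutions of [A A^* A = A], and their products *)

Section Regular.
Context {R : realType} {H : hilbertType R}.
Implicit Types (A B : bop H).

Definition regular A := A ∘ A^* ∘ A = A.

Lemma regular_id : regular (bop_id H).
Proof. by rewrite /regular adjoint_id !bop_comp1o. Qed.

Lemma regular_adjoint A : regular A -> regular A^*.
Proof.
by rewrite /regular => rA; rewrite -[in RHS]rA !adjoint_comp adjointK bop_compA.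
Qed.

(* The projection theorem is avoided: [E = A^* A] maps into the orthogonal
   complement of [ker A], on which [A] preserves norms; comparing the norms of
   [A (E x - x)] and [E x - x] there shows that [E] is the identity on it. *)
Lemma partial_isometry_regular A : partial_isometry A -> regular A.
Proof.
move=> piA.
pose perp x := forall z, A z = 0 -> inner x z = 0.
pose E x := A^* (A x).
have EP x y : inner (E x) y = inner (A x) (A y).
  by rewrite /E adjointP adjointK.
have EP' x y : inner x (E y) = inner (A x) (A y) by rewrite adjointP.
have perpE x : perp (E x).
  by move=> z Az; rewrite EP Az linear0r.
have perpB x y : perp x -> perp y -> perp (x - y).
  by move=> px py z Az; rewrite linearBl /= px ?py// subrr.
have iso x : perp x -> inner (A x) (A x) = inner x x.
  by move=> px; rewrite !inner_normE (piA _ px).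
have Eid x : perp x -> E x = x.
  move=> px; apply/eqP; rewrite -subr_eq0; apply/eqP/inner_eq0.
  have hy := iso _ (perpB _ _ (perpE x) px).
  have hE := iso _ (perpE x).
  have hx := iso _ px.
  move: hy; rewrite linearB /= !linearBl /= !linearBr /=.
  rewrite hE hx.
  have -> : inner (A (E x)) (A x) = inner (E x) (E x) by rewrite EP'.
  have -> : inner (A x) (A (E x)) = inner (E x) (E x) by rewrite -EP.
  have -> : inner (E x) x = inner x x by rewrite EP hx.
  have -> : inner x (E x) = inner x x by rewrite EP' hx.
  (* With [a = inner (E x) (E x)] and [b = inner x x], [hy] has become [- (a - b) = a - b] and the
     goal [a - b = 0]. *)
  by rewrite !subrr sub0r subr0 => /eqP; rewrite eqNr => /eqP.
have AE x : A (E x) = A x.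
  (* By [perpE], [Eid] applies to [E x], so [E] kills [E x - x] for every [x]. *)
  apply/eqP; rewrite -subr_eq0 -linearB; apply/eqP/inner_eq0.
  have -> : inner (A (E x - x)) (A (E x - x)) = inner (E (E x - x)) (E x - x).
    by rewrite EP.
  have -> : E (E x - x) = E (E x) - E x by rewrite {1}/E !linearB.
  by rewrite Eid// subrr linear0l.
by apply: bopP => x; exact: AE.
Qed.

(* If [E F] is idempotent for orthogonal projections [E = A^* A] and
   [F = B B^*], then [(F E - E F E)^* (F E - E F E) = 0]. *)
Lemma regular_comp_comm A B : regular A -> regular B -> regular (A ∘ B) ->
  A^* ∘ A ∘ (B ∘ B^*) = B ∘ B^* ∘ (A^* ∘ A).
Proof.
move=> rA rB rAB.
set E := A^* ∘ A; set F := B ∘ B^*.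
have sE : E^* = E by rewrite /E adjoint_comp adjointK.
have sF : F^* = F by rewrite /F adjoint_comp adjointK.
have EE : E ∘ E = E by rewrite /E -bop_compA (bop_compA A) rA.
have FF : F ∘ F = F by rewrite /F bop_compA rB.
have EFEF : E ∘ F ∘ E ∘ F = E ∘ F.
  (* Regularity of [A B] reads [A F E B = A B]. *)
  have := congr1 (fun X => A^* ∘ X ∘ B^*) rAB.
  by rewrite adjoint_comp /E /F !bop_compA.
move: E F sE sF EE FF EFEF => {rA rB rAB} E F sE sF EE FF EFEF.
have EFE : F ∘ E = E ∘ F ∘ E.
  apply: bopP => x /=; apply/eqP; rewrite -subr_eq0; apply/eqP/inner_eq0.
  have EEx y : E (E y) = E y by have := congr1 (fun X : bop H => X y) EE.
  have FFx y : F (F y) = F y by have := congr1 (fun X : bop H => X y) FF.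
  have EFEFx y : E (F (E (F y))) = E (F y).
    by have := congr1 (fun X : bop H => X y) EFEF.
  have EP u v : inner (E u) v = inner u (E v) by rewrite adjointP sE.
  have FP u v : inner (F u) v = inner u (F v) by rewrite adjointP sF.
  rewrite linearBl /= !linearBr /= !(EP, FP) !(FFx, EEx).
  by rewrite EFEFx !subrr.
(* [E F E] is selfadjoint, hence so is [F E]. *)
have := congr1 adjoint EFE.
by rewrite !adjoint_comp sE sF bop_compA -EFE.
Qed.

(** Swapping the middle projections turns the triple product into [(A A^* A) (B B^* B)]. *)
Lemma regular_comp A B : regular A -> regular B ->
  A^* ∘ A ∘ (B ∘ B^*) = B ∘ B^* ∘ (A^* ∘ A) -> regular (A ∘ B).
Proof.
move=> rA rB AB; rewrite /regular adjoint_comp.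
have -> : A ∘ B ∘ (B^* ∘ A^*) ∘ (A ∘ B) = A ∘ (B ∘ B^* ∘ (A^* ∘ A)) ∘ B.
  by rewrite !bop_compA.
by rewrite -AB !bop_compA rA -!bop_compA (bop_compA B) rB.
Qed.

End Regular.

(** * Initial and final projections of the powers, and the monoid they generate *)

Section PowerRegular.
Context {R : realType} {H : hilbertType R}.
Implicit Types (T P Q : bop H).

Lemma bop_powD T m n : bop_pow T (m + n) = bop_pow T m ∘ bop_pow T n.
Proof.
by elim: m => [|m IH]; rewrite ?bop_comp1o// addSn /= IH bop_compA.
Qed.

Lemma bop_powSr T n : bop_pow T n.+1 = bop_pow T n ∘ T.
Proof. by rewrite -addn1 bop_powD /= bop_compo1. Qed.

Lemma adjoint_pow T n : bop_pow T^* n = (bop_pow T n)^*.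
Proof.
elim: n => [|n IH]; first by rewrite adjoint_id.
by rewrite bop_powSr adjoint_comp -IH -bop_powSr.
Qed.

Definition power_regular T := forall n, regular (bop_pow T n).

Lemma power_partial_isometry_regular T :
  power_partial_isometry T -> power_regular T.
Proof.
move=> ppT [|n]; first exact: regular_id.
by apply: partial_isometry_regular; exact: ppT.
Qed.

Lemma power_regular_adjoint T : power_regular T -> power_regular T^*.
Proof. by move=> rT n; rewrite adjoint_pow; apply: regular_adjoint. Qed.

Lemma power_regular1 T : power_regular T -> regular T.
Proof. by move=> /(_ 1); rewrite /= bop_compo1. Qed.

Definition iproj T n := (bop_pow T n)^* ∘ bop_pow T n.
Definition fproj T n := bop_pow T n ∘ (bop_pow T n)^*.

(** Passing to [T^*] exchanges the [E_n] ([iproj]) and the [F_n] ([fproj]), so facts about one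
    family transfer to the other. *)
Lemma iproj_adjoint T n : iproj T^* n = fproj T n.
Proof. by rewrite /iproj adjoint_pow adjointK. Qed.

Lemma fproj_adjoint T n : fproj T^* n = iproj T n.
Proof. by rewrite /fproj adjoint_pow adjointK. Qed.

Lemma iproj1 T : iproj T 1 = T^* ∘ T.
Proof. by rewrite /iproj /= bop_compo1. Qed.

Lemma iproj_fproj_comm T m n : power_regular T ->
  iproj T m ∘ fproj T n = fproj T n ∘ iproj T m.
Proof. by move=> rT; apply: regular_comp_comm; rewrite // -bop_powD. Qed.

(** [T^n = T^(n-m) T^m] absorbs [E_m] on its right; adjoints give the other order. *)
Lemma iproj_comp_le T m n : power_regular T -> (m <= n)%N ->
  iproj T m ∘ iproj T n = iproj T n /\ iproj T n ∘ iproj T m = iproj T n.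
Proof.
move=> rT mn.
have nm : iproj T n ∘ iproj T m = iproj T n.
  rewrite /iproj -(subnK mn) bop_powD adjoint_comp.
  by have := rT m; rewrite /regular -!bop_compA => ->.
split=> //; have := congr1 adjoint nm.
by rewrite /iproj !adjoint_comp !adjointK.
Qed.

Lemma iproj_comm T m n : power_regular T ->
  iproj T m ∘ iproj T n = iproj T n ∘ iproj T m.
Proof.
by move=> rT; case: (leqP m n) => [|/ltnW] /(iproj_comp_le rT) [-> ->].
Qed.

Lemma fproj_comm T m n : power_regular T ->
  fproj T m ∘ fproj T n = fproj T n ∘ fproj T m.
Proof.
move=> rT; rewrite -!iproj_adjoint.
by apply: iproj_comm; exact: power_regular_adjoint.
Qed.

(** The unit enters as [iproj T 0]. *)
Inductive proj_monoid T : bop H -> Prop :=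
| proj_iproj n : proj_monoid T (iproj T n)
| proj_fproj n : proj_monoid T (fproj T n)
| proj_comp P Q : proj_monoid T P -> proj_monoid T Q -> proj_monoid T (P ∘ Q).

Lemma proj_monoid_adjoint T P : proj_monoid T P -> proj_monoid T^* P.
Proof.
elim=> [n|n|{}P Q _ IP _ IQ]; last exact: proj_comp.
- by rewrite -fproj_adjoint; exact: proj_fproj.
- by rewrite -iproj_adjoint; exact: proj_iproj.
Qed.

Lemma proj_monoid_comm T P Q : power_regular T ->
  proj_monoid T P -> proj_monoid T Q -> P ∘ Q = Q ∘ P.
Proof.
move=> rT; have gen X : (forall n, X ∘ iproj T n = iproj T n ∘ X) ->
    (forall n, X ∘ fproj T n = fproj T n ∘ X) ->
    forall Y, proj_monoid T Y -> X ∘ Y = Y ∘ X.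
  move=> Xi Xf Y; elim=> [n|n|A B _ IA _ IB]; rewrite ?Xi ?Xf//.
  by rewrite bop_compA IA -bop_compA IB bop_compA.
move=> mP mQ; elim: mP => [m|m|A B _ IA _ IB].
- by apply: gen => // n; [exact: iproj_comm|exact: iproj_fproj_comm].
- apply: gen => // n; last exact: fproj_comm.
  by rewrite iproj_fproj_comm.
- by rewrite -bop_compA IB bop_compA IA bop_compA.
Qed.

Lemma proj_monoid_conj T P : power_regular T ->
  proj_monoid T P -> proj_monoid T (T ∘ P ∘ T^*).
Proof.
move=> rT; have rT1 : T ∘ (T^* ∘ T) = T.
  by rewrite bop_compA; exact: power_regular1.
have fS n : T ∘ fproj T n ∘ T^* = fproj T n.+1.
  by rewrite /fproj /= adjoint_comp !bop_compA.
elim=> [[|n]|n|{}P Q mP IP mQ IQ].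
- have -> : iproj T 0 = fproj T 0 by rewrite /iproj /fproj /= adjoint_id.
  by rewrite fS; exact: proj_fproj.
(* Splitting the inner copies of [T^*] and [T] off [E_(n+1)] leaves [T T^* = F_1] on both sides of
   [E_n]. *)
- have -> : T ∘ iproj T n.+1 ∘ T^* = fproj T 1 ∘ iproj T n ∘ fproj T 1.
    rewrite /iproj /fproj bop_powSr adjoint_comp /= bop_compo1.
    by rewrite !bop_compA.
  by apply: proj_comp (proj_fproj T 1); apply: proj_comp (proj_iproj T n);
    exact: proj_fproj.
- by rewrite fS; exact: proj_fproj.
(* Conjugation by [T] is multiplicative here: [T^* T = E_1] moves past [P] and is absorbed by
   [T]. *)
have -> : T ∘ (P ∘ Q) ∘ T^* = (T ∘ P ∘ T^*) ∘ (T ∘ Q ∘ T^*).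
  have comm : P ∘ (T^* ∘ T) = T^* ∘ T ∘ P.
    by apply: (proj_monoid_comm rT) => //; rewrite -iproj1; exact: proj_iproj.
  have -> : (T ∘ P ∘ T^*) ∘ (T ∘ Q ∘ T^*) = T ∘ (P ∘ (T^* ∘ T)) ∘ Q ∘ T^*.
    by rewrite !bop_compA.
  by rewrite comm (bop_compA T (_ ∘ T)) rT1 !bop_compA.
exact: proj_comp.
Qed.

End PowerRegular.

(** * Words in [T] and [T^*] *)

Section Words.
Context {R : realType} {H : hilbertType R} (T : bop H).

Lemma word_bop_cons b w :
  word_bop T (b :: w) = (if b then T^* else T) ∘ word_bop T w.
Proof. exact: big_cons. Qed.

Lemma word_bop_cat w1 w2 :
  word_bop T (w1 ++ w2) = word_bop T w1 ∘ word_bop T w2.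
Proof. exact: big_cat. Qed.

Lemma adjoint_word w : (word_bop T w)^* = word_bop T (rev (map negb w)).
Proof.
elim: w => [|b w IH]; first by rewrite /word_bop !big_nil adjoint_id.
rewrite word_bop_cons adjoint_comp IH rev_cons -cats1 word_bop_cat.
congr (_ ∘ _); rewrite word_bop_cons /word_bop big_nil bop_compo1.
by case: b; rewrite /= ?adjointK.
Qed.

(** The second conjunct carries the induction: it makes [W W^*] commute with [L^* L], which is [E_1]
    or [F_1], as [regular_comp] requires for [L W]. *)
Lemma word_regular w : power_regular T ->
  regular (word_bop T w) /\ proj_monoid T (word_bop T w ∘ (word_bop T w)^*).
Proof.
move=> rT; elim: w => [|b w [rw mw]].
  rewrite /word_bop big_nil; split; first exact: regular_id.
  exact: (proj_fproj T 0).
have rTs := power_regular_adjoint rT.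
rewrite word_bop_cons; set W := word_bop T w in rw mw *.
set L := if b then _ else _.
have rL : regular L by rewrite /L; case: (b); exact: power_regular1.
have mL : proj_monoid T (L^* ∘ L).
  rewrite -iproj1 /L; case: (b); last exact: proj_iproj.
  by rewrite iproj_adjoint; exact: proj_fproj.
split; first by apply: regular_comp => //; exact: (proj_monoid_comm rT).
rewrite adjoint_comp.
have -> : L ∘ W ∘ (W^* ∘ L^*) = L ∘ (W ∘ W^*) ∘ L^* by rewrite !bop_compA.
rewrite /L; case: (b); last exact: proj_monoid_conj.
(* [T^* P T] is conjugation by [T^*], and [T] and [T^*] have the same monoid. *)
rewrite -[T in proj_monoid T _]adjointK; apply: proj_monoid_adjoint.
by apply: proj_monoid_conj => //; exact: proj_monoid_adjoint.
Qed.

End Words.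

Theorem corollary1p15 (R : realType) (H : hilbertType R) (T : bop H) :
  power_partial_isometry T -> SI_semigroup (semigroup_TTs T).
Proof.
move=> /power_partial_isometry_regular rT; split.
  move=> _ _ [w1 w1N0 ->] [w2 _ ->]; exists (w1 ++ w2).
    by case: w1 w1N0.
  by rewrite word_bop_cat.
move=> J [JS Jid] _ [A JA <-].
have [w wN0 Aw] := JS _ JA.
(* Absorption into [J] allows only multipliers from the semigroup, so [A^*] must itself be a
   nonempty word. *)
have SAs : semigroup_TTs T A^*.
  exists (rev (map negb w)); last by rewrite Aw adjoint_word.
  by rewrite -size_eq0 size_rev size_map size_eq0.
have rA : regular A^*.
  by rewrite Aw; apply: regular_adjoint; case: (word_regular w rT).
rewrite -rA adjointK.
by apply: (proj2 (Jid _ _ _ _)) => //; apply: (proj1 (Jid _ _ _ _)).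
Qed.
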